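(* Let $\sigma\in\mathfrak{S}_n$ be a simsun permutation that avoids the pattern $213$. Then $\sigma^{-1}$ is simsun if and only if either $\sigma$ contains no $4132$-pattern, or every occurrence of a $4132$-pattern in $\sigma$ is contained in an occurrence of a $51342$-pattern in $\sigma$.
   Context: For $\sigma\in\mathfrak{S}_n$, a double descent is an index $i$ with $\sigma_i>\sigma_{i+1}>\sigma_{i+2}$. The permutation $\sigma$ is simsun if for every $k$, the subword of $\sigma$ consisting of the letters in $\{1,\dots,k\}$ (in the order they appear in $\sigma$) has no double descent. For $\omega\in\mathfrak{S}_t$, an occurrence of an $\omega$-pattern in $\sigma$ is a sequence of indices $i_1<\cdots<i_t$ with $\sigma_{i_j}<\sigma_{i_k}$ iff $\omega_j<\omega_k$; $\sigma$ avoids $\omega$ if there is no occurrence. An occurrence of a $4132$-pattern at indices $i_1<i_2<i_3<i_4$ is contained in an occurrence of a $51342$-pattern if there is an occurrence of $51342$ at indices $j_1<\dots<j_5$ with $\{i_1,i_2,i_3,i_4\}\subseteq\{j_1,\dots,j_5\}$. *)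

(* Defs.v *)
From mathcomp Require Import all_boot all_fingroup.

Set Implicit Arguments.
Unset Strict Implicit.
Unset Printing Implicit Defensive.

(* A permutation in 'S_n acts on {0, ..., n-1}: both positions and letters are
   shifted down by one with respect to the usual {1, ..., n}. *)

Definition one_line (n : nat) (s : 'S_n) : seq nat :=
  [seq nat_of_ord (s i) | i <- enum 'I_n].

Definition has_double_descent (w : seq nat) : Prop :=
  exists i : nat,
    i.+2 < size w /\ nth 0 w i.+2 < nth 0 w i.+1 < nth 0 w i.

(* With letters starting at 0, the k smallest letters are those x < k. *)
Definition simsun (n : nat) (s : 'S_n) : Prop :=
  forall k : nat, ~ has_double_descent [seq x <- one_line s | x < k].

(* A pattern is given by its one-line word, e.g. [tuple 2; 1; 3] for 213; only
   the relative order of its letters matters, so these may start at 1. *)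
Definition occurrence (n t : nat) (p : t.-tuple nat) (s : 'S_n)
    (i : t.-tuple 'I_n) : Prop :=
  (forall j k : 'I_t, j < k -> tnth i j < tnth i k) /\
  (forall j k : 'I_t,
     (s (tnth i j) < s (tnth i k)) <-> (tnth p j < tnth p k)).

Definition avoids (n t : nat) (p : t.-tuple nat) (s : 'S_n) : Prop :=
  ~ exists i : t.-tuple 'I_n, occurrence p s i.

Definition contained_in_occurrence (n t u : nat) (q : u.-tuple nat)
    (s : 'S_n) (i : t.-tuple 'I_n) : Prop :=
  exists j : u.-tuple 'I_n, occurrence q s j /\ {subset i <= j}.

Definition pat213 : 3.-tuple nat := [tuple 2; 1; 3].
Definition pat4132 : 4.-tuple nat := [tuple 4; 1; 3; 2].
Definition pat51342 : 5.-tuple nat := [tuple 5; 1; 3; 4; 2].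

(* Main.v *)
(* A permutation is simsun iff there are no positions i < j < l with
   s i > s j > s l such that every other letter between them exceeds s i
   (restrict to the letters up to s i). For the inverse of s such an obstruction
   consists of letters z > y > x at positions i < j < l such that every other
   letter in ]x, z[ lies to the right of x.

   If s itself has no obstruction, some letter a < x must occur between z and y;
   then z a y x is a 4132 which no letter can complete to a 51342. Conversely, in
   an uncontained 4132 with letters z a y x, replace x by the first letter after y
   in [x, y[, and z by the smallest letter above y to the left of y; avoidance of
   213 makes the resulting decreasing triple an obstruction for the inverse. *)

Require Import Defs.
From mathcomp Require Import all_boot all_fingroup.
From mathcomp Require Import zify.

Definition descent_obstruction {n : nat} (s : 'S_n) (i j l : 'I_n) : Prop :=
  [/\ i < j < l, s l < s j < s i &
      forall m : 'I_n, i < m < l -> m != j -> s i < s m].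

Lemma sorted_filter_enum_ord {n : nat} {P : pred 'I_n} :
  sorted (fun i j : 'I_n => i < j) [seq i <- enum 'I_n | P i].
Proof.
apply: sorted_filter; first by move=> j i k; apply: ltn_trans.
by rewrite -(@sorted_map _ _ val ltn) val_enum_ord iota_ltn_sorted.
Qed.

Lemma ltn_nth_filter_enum_ord {n : nat} {P : pred 'I_n} (x : 'I_n) (p q : nat) :
  let w := [seq i <- enum 'I_n | P i] in
  p < size w -> q < size w -> (nth x w p < nth x w q) = (p < q).
Proof.
move=> w lt_p lt_q.
have mono a b : a < b -> b < size w -> nth x w a < nth x w b.
  move=> lt_ab lt_b; have tr : transitive (fun i j : 'I_n => i < j).
    by move=> j i k; apply: ltn_trans.
  have lt_a := ltn_trans lt_ab lt_b.
  exact: (sorted_ltn_nth tr x (@sorted_filter_enum_ord _ P)) lt_ab.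
have [lt_pq|lt_qp|->] := ltngtP p q; last by rewrite ltnn.
  exact: mono.
by apply/negbTE; rewrite -leqNgt ltnW // mono.
Qed.

Lemma simsunP {n : nat} {s : 'S_n} :
  simsun s <-> forall i j l : 'I_n, ~ descent_obstruction s i j l.
Proof.
have restrE k : [seq x <- one_line s | x < k] =
    [seq nat_of_ord (s i) | i <- [seq i <- enum 'I_n | s i < k]].
  by rewrite /one_line filter_map.
split=> [sim i j l [/andP[lt_ij lt_jl] /andP[lt_lj lt_ji] gap]|no_obs k].
  (* The bound in the filter is strict, so [(s i).+1] keeps the letter [s i] itself; by the gap
     condition, [j] is the only position kept strictly between [i] and [l]. *)
  apply: (sim (s i).+1); rewrite restrE.
  set P := fun m : 'I_n => s m < (s i).+1; set w := filter _ _.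
  have mem_w m : s m <= s i -> m \in w by move=> le_m; rewrite mem_filter mem_enum andbT.
  have iw : i \in w by apply: mem_w.
  have jw : j \in w by apply: mem_w; lia.
  have lw : l \in w by apply: mem_w; lia.
  have ltE p q : p < size w -> q < size w -> (nth i w p < nth i w q) = (p < q).
    exact: ltn_nth_filter_enum_ord.
  (* Kept positions [a < b] between [i] and [l] are neighbours in [w]: by the gap condition an entry
     indexed between them could only be [j], which the last premise rules out. *)
  have next a b : a \in w -> b \in w -> a < b -> i <= a -> b <= l ->
      (a < j -> b <= j) -> index b w = (index a w).+1.
    move=> aw bw lt_ab le_ia le_bl le_bj.
    have ia : index a w < size w by rewrite index_mem.
    have ib : index b w < size w by rewrite index_mem.
    have lt_idx : index a w < index b w by rewrite -ltE // !nth_index.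
    apply/eqP; rewrite eqn_leq lt_idx andbT leqNgt; apply/negP => lt_c.
    have lc := ltn_trans lt_c ib.
    have := ltE _ _ ia lc; have := ltE _ _ lc ib.
    rewrite !nth_index // lt_c ltnSn; set c := nth i w _ => lt_cb lt_ac.
    have : c \in w by apply: mem_nth.
    rewrite mem_filter /P => /andP[le_c _].
    have cj : c != j.
      by apply/eqP => cj; move: le_bj lt_cb lt_ac; rewrite cj; lia.
    by have := gap c _ cj; lia.
  have ij : index j w = (index i w).+1 by apply: next => //; lia.
  have jl : index l w = (index j w).+1 by apply: next => //; lia.
  exists (index i w); rewrite size_map.
  have ltl : index l w < size w by rewrite index_mem.
  split; first by rewrite -ij -jl.
  by rewrite !(nth_map i) -?ij -?jl ?nth_index ?lt_lj ?lt_ji ?index_mem ?index_size.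
case=> p []; rewrite restrE size_map; set w := filter _ _ => lt_p.
(* Since [w] is nonempty, it provides the default element for [nth]. *)
have [x _] : exists x : 'I_n, true.
  by case E : w lt_p => [|x w'] // _; exists x.
have ltE a b : a < size w -> b < size w -> (nth x w a < nth x w b) = (a < b).
  exact: ltn_nth_filter_enum_ord.
have [lt_p0 lt_p1] : p < size w /\ p.+1 < size w by lia.
rewrite !(nth_map x) //.
move=> desc; apply: (no_obs (nth x w p) (nth x w p.+1) (nth x w p.+2)).
split=> //; first by rewrite !ltE ?ltnSn.
(* A position [m] violating the gap condition would itself be kept, at an index strictly between [p]
   and [p.+2]. *)
move=> m lt_m neq_m; rewrite ltnNge; apply/negP => le_m.
have : nth x w p \in w by apply: mem_nth.
rewrite mem_filter => /andP[lt_k _].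
have mw : m \in w by rewrite mem_filter mem_enum andbT; lia.
have im : index m w < size w by rewrite index_mem.
have mE := nth_index x mw; move: lt_m neq_m; rewrite -mE !ltE //; try lia.
by move=> lt_i /eqP[]; congr (nth _ _ _); lia.
Qed.

(** With [nth] and numerals in place of [tnth] and ordinals, the conditions compute on explicit
    tuples and become accessible to [lia]. *)
Lemma occurrenceP {n t : nat} {p : t.-tuple nat} {s : 'S_n} {i : t.-tuple 'I_n}
    (x : 'I_n) :
  occurrence p s i <->
  (forall a b, a < t -> b < t -> (a < b -> nth x i a < nth x i b) /\
    (s (nth x i a) < s (nth x i b)) = (nth 0 p a < nth 0 p b)).
Proof.
split=> [[pos val] a b lt_a lt_b|occ].
  move: (pos (Ordinal lt_a) (Ordinal lt_b)) (val (Ordinal lt_a) (Ordinal lt_b)).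
  by rewrite !(tnth_nth x) !(tnth_nth 0) /= => ? ?; split=> //; apply/idP/idP; tauto.
split=> a b; have [pos val] := occ a b (ltn_ord a) (ltn_ord b);
  by rewrite !(tnth_nth x) ?(tnth_nth 0) // val.
Qed.

Lemma occurrence213 {n : nat} {s : 'S_n} {a b c : 'I_n} :
  a < b < c -> s b < s a < s c -> occurrence pat213 s [tuple a; b; c].
Proof.
move=> pos val; apply/(occurrenceP a) => -[|[|[|u]]] [|[|[|v]]] //= _ _; split=> //; lia.
Qed.

Lemma occurrence4132P {n : nat} {s : 'S_n} {a b c d : 'I_n} :
  occurrence pat4132 s [tuple a; b; c; d] <->
  a < b < c /\ c < d /\ s b < s d < s c /\ s c < s a.
Proof.
split=> [/(occurrenceP a) occ|H].
  move: (occ 0 1 isT isT) (occ 1 2 isT isT) (occ 2 3 isT isT) (occ 1 3 isT isT)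
    (occ 3 2 isT isT) (occ 2 0 isT isT) => /=; lia.
by apply/(occurrenceP a) => -[|[|[|[|u]]]] [|[|[|[|v]]]] //= _ _; split=> //; lia.
Qed.

Lemma occurrence51342P {n : nat} {s : 'S_n} {a b c d e : 'I_n} :
  occurrence pat51342 s [tuple a; b; c; d; e] <->
  a < b < c /\ c < d < e /\ s b < s e < s c /\ s c < s d < s a.
Proof.
split=> [/(occurrenceP a) occ|H].
  move: (occ 0 1 isT isT) (occ 1 2 isT isT) (occ 2 3 isT isT) (occ 3 4 isT isT)
    (occ 1 4 isT isT) (occ 4 2 isT isT) (occ 2 3 isT isT) (occ 3 0 isT isT) => /=; lia.
by apply/(occurrenceP a) => -[|[|[|[|[|u]]]]] [|[|[|[|[|v]]]]] //= _ _; split=> //; lia.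
Qed.

(* The extra letter of a 51342 containing a given 4132 plays the 3 or the 4. *)
Lemma contained_51342P {n : nat} {s : 'S_n} {a b c d : 'I_n} :
  occurrence pat4132 s [tuple a; b; c; d] ->
  contained_in_occurrence pat51342 s [tuple a; b; c; d] <->
  exists v : 'I_n, (b < v < c /\ s d < s v < s c) \/ (c < v < d /\ s c < s v < s a).
Proof.
move=> /occurrence4132P occ; split=> [[j [+ sub]]|[v cases]].
  case: j sub => [[|j0 [|j1 [|j2 [|j3 [|j4 [|]]]]]] // sz] sub.
  have -> : Tuple sz = [tuple j0; j1; j2; j3; j4] by apply: val_inj.
  move/occurrence51342P => occ5.
  have sub' m : m \in [:: a; b; c; d] -> [\/ m = j0, m = j1, m = j2 | m = j3 \/ m = j4].
    move=> /sub; rewrite !inE => /or4P[|||/orP[]] /eqP->;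
      by [constructor 1|constructor 2|constructor 3|constructor 4; left|constructor 4; right].
  have := sub' a; have := sub' b; have := sub' c; have := sub' d.
  rewrite !inE !eqxx ?orbT => /(_ isT) dE /(_ isT) cE /(_ isT) bE /(_ isT) aE.
  clear sub sub'; move: occ.
  (* Positions and letters force [a = j0], [b = j1], [d = j4], and [c] is [j2] or [j3]; the other of
     these two is the witness. *)
  case: aE => [->|->|->|[]->]; case: bE => [->|->|->|[]->] occ; (try by exfalso; lia);
    move: occ; case: cE => [->|->|->|[]->]; case: dE => [->|->|->|[]->] occ; try by exfalso; lia.
    by exists j3; lia.
  by exists j2; lia.
have [pos|pos] := cases.
  exists [tuple a; b; v; c; d]; split; first by apply/occurrence51342P; lia.
  by move=> m; rewrite !inE => /or4P[] /eqP->; rewrite eqxx ?orbT.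
exists [tuple a; b; c; v; d]; split; first by apply/occurrence51342P; lia.
by move=> m; rewrite !inE => /or4P[] /eqP->; rewrite eqxx ?orbT.
Qed.

Lemma uncontained_descent_obstruction_inv {n : nat} {s : 'S_n} {a b c d : 'I_n} :
    avoids pat213 s -> occurrence pat4132 s [tuple a; b; c; d] ->
    ~ contained_in_occurrence pat51342 s [tuple a; b; c; d] ->
  exists x y z : 'I_n, descent_obstruction s^-1 x y z.
Proof.
move=> av occ ncont.
have {ncont} no_v v := fun H => ncont (proj2 (contained_51342P occ) (ex_intro _ v H)).
move/occurrence4132P: occ => occ.
(* Here the position is minimized, and for [a'] the letter. *)
have [|d' /andP[lt_cd' /andP[le_dd' lt_d'c]] d'_min] :=
  @arg_minnP _ d [pred m : 'I_n | c < m & s d <= s m < s c] val; first by rewrite /=; lia.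
have [|a' /andP[lt_a'c lt_ca'] a'_min] :=
  @arg_minnP _ a [pred m : 'I_n | m < c & s c < s m] (fun m => s m); first by rewrite /=; lia.
have le_d'd : d' <= d by apply: d'_min; rewrite /=; lia.
have le_a'a : s a' <= s a by apply: a'_min; rewrite /=; lia.
exists (s d'), (s c), (s a'); split; rewrite ?permK; try lia.
move=> y lt_y neq_y; rewrite ltnNge; apply/negP.
set m := (s^-1)%g y; have ym : y = s m by rewrite permKV.
move: lt_y neq_y; rewrite {}ym => lt_m; rewrite (inj_eq perm_inj) => neq_m le_m.
have neq_mc : nat_of_ord m <> c by move=> /val_inj/eqP; apply/negP.
have neq_sm : nat_of_ord (s m) <> s c by move=> /val_inj/perm_inj/val_eqP/eqP.
have neq_md : nat_of_ord m <> d' by move=> /val_inj E; move: lt_m; rewrite E; lia.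
have neq_mb : nat_of_ord m <> b by move=> /val_inj E; move: lt_m; rewrite E; lia.
(* Four quadrants around the point at [c]. Lower left: [m] forms a 213 with [b] and [c], or plays
   the 3 of a 51342. Upper left and lower right: the choices of [a'] and [d'] are contradicted.
   Upper right: [m] plays the 4. *)
have [lt_mc|lt_cm] : m < c \/ c < m by lia.
  have [lt_sm|lt_sm] : s m < s c \/ s c < s m by lia.
    have [lt_mb|lt_bm] : m < b \/ b < m by lia.
      by apply: av; exists [tuple m; b; c]; apply: occurrence213; lia.
    by apply: (no_v m); lia.
  have : s a' <= s m by apply: a'_min; rewrite /=; lia.
  lia.
have [lt_sm|lt_sm] : s m < s c \/ s c < s m by lia.
  have : d' <= m by apply: d'_min; rewrite /=; lia.
  lia.
by apply: (no_v m); lia.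
Qed.

Lemma descent_obstruction_inv_uncontained {n : nat} {s : 'S_n} {x y z : 'I_n} :
    simsun s -> descent_obstruction s^-1 x y z ->
  exists i : 4.-tuple 'I_n, occurrence pat4132 s i /\
    ~ contained_in_occurrence pat51342 s i.
Proof.
move=> /simsunP no_obs.
rewrite /descent_obstruction -[x](permKV s) -[y](permKV s) -[z](permKV s) !permK.
(* From here on, [d], [c], [a] are the positions of the letters [x], [y], [z]. *)
move: ((s^-1)%g x) ((s^-1)%g y) ((s^-1)%g z) => d c a [lt_s lt_p gap].
have {}gap m : s d < s m < s a -> m != c -> d < m.
  by move=> lt_m neq_m; have := gap (s m); rewrite permK (inj_eq perm_inj); apply.
have neq_s (u v : 'I_n) : u != v -> nat_of_ord (s u) <> s v.
  by move=> /eqP neq /val_inj/perm_inj.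
have [b /and3P[lt_ab lt_bc lt_bd]|no_b] :=
    pickP [pred m : 'I_n | [&& a < m, m < c & s m < s d]].
  have occ : occurrence pat4132 s [tuple a; b; c; d].
    by apply/occurrence4132P; lia.
  exists [tuple a; b; c; d]; split=> // /(contained_51342P occ)[v v_pos].
  (* Either role of [v] puts it left of [d], but its letter lies strictly between [s d] and
     [s a]. *)
  have : d < v by apply: gap; [lia|apply/eqP => E; move: v_pos; rewrite E; lia].
  lia.
(* Without such a [b], the first position [e] after [c] with a letter below [s c] makes [a], [c],
   [e] an obstruction for [s]. *)
have [|e /andP[lt_ce lt_ec] e_min] :=
  @arg_minnP _ d [pred m : 'I_n | c < m & s m < s c] val; first by rewrite /=; lia.
have le_ed : e <= d by apply: e_min; rewrite /=; lia.
case: (no_obs a c e); split; try lia.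
move=> m lt_m neq_m; rewrite ltnNge; apply/negP => le_ma.
have neq_mc : nat_of_ord m <> c by move=> /val_inj/eqP; apply/negP.
have neq_sma : nat_of_ord (s m) <> s a.
  by apply: neq_s; apply/eqP => E; move: lt_m; rewrite E ltnn.
have neq_smd : nat_of_ord (s m) <> s d.
  by apply: neq_s; apply/eqP => E; move: lt_m; rewrite E; lia.
(* Otherwise [gap] would put [m] right of [d], hence right of [e]. *)
have lt_md : s m < s d.
  by rewrite ltnNge; apply/negP => le_dm; have := gap m _ neq_m; lia.
have [lt_mc|lt_cm] : m < c \/ c < m by lia.
  by have := no_b m; rewrite /= lt_mc lt_md; lia.
have : e <= m by apply: e_min; rewrite /=; lia.
lia.
Qed.

Theorem theorem3p5 (n : nat) (s : 'S_n)
    (s_simsun : simsun s) (s_av213 : avoids pat213 s) :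
  simsun (s^-1)%g <->
  (avoids pat4132 s \/
   forall i : 4.-tuple 'I_n,
     occurrence pat4132 s i -> contained_in_occurrence pat51342 s i).
Proof.
split=> [sim_inv|all_cont].
  right=> i; case: i => [[|a [|b [|c [|d [|]]]]] // sz].
  have -> : Tuple sz = [tuple a; b; c; d] by apply: val_inj.
  move=> occ; apply/(contained_51342P occ).
  have [v|no_v] := pickP [pred v : 'I_n |
    [&& b < v, v < c, s d < s v & s v < s c] || [&& c < v, v < d, s c < s v & s v < s a]].
    by move=> /= v_pos; exists v; lia.
  have [|x [y [z obs]]] := uncontained_descent_obstruction_inv s_av213 occ.
    by move=> /(contained_51342P occ)[v v_pos]; have := no_v v; rewrite /=; lia.
  by move/simsunP: sim_inv => /(_ _ _ _ obs).
apply/simsunP => x y z /(descent_obstruction_inv_uncontained s_simsun) [i [occ ncont]].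
case: all_cont => [av|cont]; first by apply: av; exists i.
exact/ncont/cont.
Qed.
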